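(* For every positive integer $k$, the following identity of formal power series in $q$ (equivalently, of analytic functions for $|q|<1$) holds: \[ \sum_{j=0}^{k-1} (-1)^j q^{\frac{j(3j-1)}{2}} \left( 1 + q^{j} \right) = 1 - \frac{ (-1)^{k} q^{\frac{k(3k-1)}{2}} }{ 1 - q^{k} + q^{2k} } + (q;q)_{\infty} \left( 1 - \frac{ (1-q) (-q)^{k} }{q \left( 1 - q^{k} + q^{2k} \right) } \sum_{n = 2}^{\infty} \frac{ q^{\binom{k}{2} + (k + 1) n } }{ (q; q)_{n} } \begin{bmatrix} n - 2 \\ k - 1 \end{bmatrix}_{q} \right). \]
   Context: The $q$-Pochhammer symbol is $(a;q)_n=\prod_{i=0}^{n-1}(1-aq^i)$ for integers $n\ge 0$ and $(a;q)_\infty=\prod_{i=0}^{\infty}(1-aq^i)$. The $q$-binomial coefficient is $\begin{bmatrix} n \\ k \end{bmatrix}_{q}=\frac{(q;q)_n}{(q;q)_k(q;q)_{n-k}}$ if $0\le k\le n$ and $0$ otherwise. *)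

(* Defs.v *)
From Stdlib Require Export Reals.
From Coquelicot Require Export Coquelicot.

Open Scope C_scope.

Fixpoint qpoch (a q : C) (n : nat) : C :=
  match n with
  | O => 1
  | S m => qpoch a q m * (1 - a * q ^ m)
  end.

(* Relational, so that asserting it includes convergence of the infinite product. *)
Definition is_qpoch_inf (a q P : C) : Prop :=
  filterlim (qpoch a q) eventually (locally P).

Definition qbinom (q : C) (n k : nat) : C :=
  if Nat.leb k n then qpoch q q n / (qpoch q q k * qpoch q q (n - k)) else 0.

(* Main.v *)
(** Let F(k,j) = sum_m q^(km) / ((q;q)_m (1 - q^(m+j))) and
    E(k) = sum_m q^(km) / (q;q)_m, which equals (q;q)_(k-1) / (q;q)_oo by Euler.
    Termwise, F(k,j) - q^j F(k+1,j) = E(k) and F(k,j) - F(k+1,j) = q^k F(k,j+1).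
    Hence G(k) = F(k,k) / E(k) satisfies G(k) + q^(3k+1) G(k+1) = 1 + q^k, and
    induction on k shows that the left-hand side of the theorem is
    1 + (q;q)_oo - (-1)^k q^(k(3k-1)/2) G(k).  The series of the theorem is, after
    its vanishing terms are dropped and partial fractions are taken, a multiple of
    F(k+1,k) - q F(k+1,k+1), which the same relations express through F(k,k)
    and E(k); this is where the factor 1 - q^k + q^(2k) appears. *)

From Stdlib Require Import Lia Lra.
Require Import Defs.

(** * Series of complex numbers and the ratio test *)

Lemma is_series_C_ext (a b : nat -> C) (A : C) :
  (forall n, a n = b n) -> is_series a A -> is_series b A.
Proof. exact (is_series_ext a b A). Qed.

Lemma is_series_C_plus (a b : nat -> C) (A B : C) :
  is_series a A -> is_series b B -> is_series (fun n => a n + b n) (A + B).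
Proof. exact (is_series_plus a b A B). Qed.

Lemma is_series_C_scal (c : C) (a : nat -> C) (A : C) :
  is_series a A -> is_series (fun n => c * a n) (c * A).
Proof. exact (is_series_scal c a A). Qed.

Lemma is_series_C_decr_1 (a : nat -> C) (A : C) :
  is_series (fun n => a (S n)) (A - a O) -> is_series a A.
Proof. exact (is_series_decr_1 a A). Qed.

Lemma is_series_C_unique (a : nat -> C) (A B : C) :
  is_series a A -> is_series a B -> A = B.
Proof. apply (filterlim_locally_unique (sum_n a)). Qed.

Lemma ex_series_C_le (a : nat -> C) (b : nat -> R) :
  (forall n, Cmod (a n) <= b n)%R -> ex_series b -> exists A : C, is_series a A.
Proof. exact (@ex_series_le C_AbsRing C_CompleteNormedModule a b). Qed.

(** The tail from [N] on is dominated by a geometric series. The offset [N] is what the applications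
    need, where the ratios are only eventually close to [Cmod q]. *)
Lemma ex_series_C_ratio (a : nat -> C) (rho : R) (N : nat) :
  (0 <= rho < 1)%R ->
  (forall n, (N <= n)%nat -> Cmod (a (S n)) <= rho * Cmod (a n))%R ->
  ex_series (fun n => Cmod (a n)).
Proof.
  intros Hrho Ha.
  apply (ex_series_incr_n _ N).
  assert (Hb : forall n, (Cmod (a (N + n)%nat) <= Cmod (a N) * rho ^ n)%R).
  { induction n as [|n IH].
    - rewrite Nat.add_0_r; simpl; lra.
    - replace (N + S n)%nat with (S (N + n)) by lia.
      eapply Rle_trans; [apply Ha; lia|]. simpl. nra. }
  apply (@ex_series_le R_AbsRing R_CompleteNormedModule _
           (fun n => Cmod (a N) * rho ^ n)%R).
  - intros n. change (norm (Cmod (a (N + n)%nat))) with (Rabs (Cmod (a (N + n)%nat))).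
    rewrite Rabs_pos_eq; [apply Hb|apply Cmod_ge_0].
  - apply (ex_series_scal_l (K := R_AbsRing) (Cmod (a N)) (fun n => (rho ^ n)%R)).
    apply ex_series_geom. rewrite Rabs_pos_eq; lra.
Qed.

(** * Bounds on moduli and nonvanishing denominators *)

Lemma Cmod_pow_le (q : C) (n : nat) : (Cmod q < 1)%R -> (0 < n)%nat -> (Cmod (q ^ n) <= Cmod q)%R.
Proof.
  intros hq hn. rewrite Cmod_pow. destruct n as [|n]; [lia|]. simpl.
  pose proof (Cmod_ge_0 q). pose proof (pow_le (Cmod q) n H).
  assert (Cmod q ^ n <= 1)%R by (rewrite <- (pow1 n); apply pow_incr; lra).
  nra.
Qed.

Lemma Cmod_one_minus_ge (x : C) : (1 - Cmod x <= Cmod (1 - x))%R.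
Proof.
  pose proof (Cmod_triangle (1 - x) x) as H.
  replace (1 - x + x) with (RtoC 1) in H by ring. rewrite Cmod_1 in H. lra.
Qed.

Lemma Cmod_one_minus_le (x : C) : (Cmod (1 - x) <= 1 + Cmod x)%R.
Proof.
  pose proof (Cmod_triangle 1 (- x)) as H. rewrite Cmod_1, Cmod_opp in H. exact H.
Qed.

Lemma one_minus_neq_0 (x : C) : (Cmod x < 1)%R -> 1 - x <> 0.
Proof.
  intros hx H. pose proof (Cmod_one_minus_ge x). rewrite H, Cmod_0 in H0. lra.
Qed.

Lemma one_minus_pow_neq_0 (q : C) (n : nat) : (Cmod q < 1)%R -> (0 < n)%nat -> 1 - q ^ n <> 0.
Proof.
  intros hq hn. apply one_minus_neq_0. pose proof (Cmod_pow_le q n hq hn). lra.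
Qed.

Lemma qpoch_S (q : C) (n : nat) : qpoch q q (S n) = qpoch q q n * (1 - q ^ S n).
Proof. reflexivity. Qed.

Lemma qpoch_neq_0 (q : C) (n : nat) : (Cmod q < 1)%R -> qpoch q q n <> 0.
Proof.
  intros hq. induction n as [|n IH].
  - exact C1_nz.
  - rewrite qpoch_S. apply Cmult_neq_0; [exact IH|].
    apply one_minus_pow_neq_0; [exact hq|lia].
Qed.

(** Multiplication by 1 + x gives 1 + x^3, which cannot vanish inside the unit disc. *)
Lemma cyclotomic6_neq_0 (x : C) : (Cmod x < 1)%R -> 1 - x + x ^ 2 <> 0.
Proof.
  intros hx H.
  apply (one_minus_neq_0 (- x ^ 3)).
  - rewrite Cmod_opp. pose proof (Cmod_pow_le x 3 hx ltac:(lia)). lra.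
  - replace (1 - - x ^ 3) with ((1 + x) * (1 - x + x ^ 2)) by ring.
    rewrite H. ring.
Qed.

(** * Convergence of the infinite product and Euler's series E(1) *)

Lemma pow_eventually_small (r : R) :
  (0 <= r < 1)%R -> exists N, forall n, (N <= n)%nat -> (r ^ n <= (1 - r) / 2)%R.
Proof.
  intros hr.
  destruct (pow_lt_1_zero r ltac:(rewrite Rabs_pos_eq; lra) ((1 - r) / 2) ltac:(lra)) as [N HN].
  exists N. intros n hn. specialize (HN n hn).
  rewrite Rabs_pos_eq in HN; [lra|apply pow_le; lra].
Qed.

Lemma ex_series_Cmod_euler (q : C) :
  (Cmod q < 1)%R -> ex_series (fun m => Cmod (q ^ m / qpoch q q m)).
Proof.
  intros hq. pose proof (Cmod_ge_0 q) as h0.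
  destruct (pow_eventually_small (Cmod q) ltac:(lra)) as [N HN].
  (* Write r = |q|. From [N] on, the ratio q / (1 - q^(n+1)) has modulus at most r / (1 - (1-r)/2) =
     2r / (1+r), which is at most (1+r)/2 because (1-r)^2 >= 0. *)
  apply (ex_series_C_ratio _ ((1 + Cmod q) / 2) N); [lra|].
  intros n hn.
  assert (hS : 1 - q ^ S n <> 0) by (apply one_minus_pow_neq_0; [exact hq|lia]).
  pose proof (qpoch_neq_0 q n hq) as hp.
  replace (q ^ S n / qpoch q q (S n)) with (q ^ n / qpoch q q n * (q / (1 - q ^ S n)))
    by (rewrite qpoch_S, Cpow_S in *; field; split; assumption).
  rewrite Cmod_mult, Rmult_comm.
  apply Rmult_le_compat_r; [apply Cmod_ge_0|].
  rewrite Cmod_div by exact hS.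
  pose proof (Cmod_one_minus_ge (q ^ S n)) as h1.
  rewrite Cmod_pow in h1. specialize (HN (S n) ltac:(lia)).
  apply Rle_div_l; nra.
Qed.

(** These terms are the differences (q;q)_m - (q;q)_(m+1), so their summability yields the limit of
    the partial products. *)
Lemma ex_series_Cmod_qpoch_diff (q : C) :
  (Cmod q < 1)%R -> ex_series (fun m => Cmod (q ^ S m * qpoch q q m)).
Proof.
  intros hq. pose proof (Cmod_ge_0 q) as h0.
  destruct (pow_eventually_small (Cmod q) ltac:(lra)) as [N HN].
  apply (ex_series_C_ratio _ ((1 + Cmod q) / 2) N); [lra|].
  intros n hn.
  replace (q ^ S (S n) * qpoch q q (S n)) with (q * (1 - q ^ S n) * (q ^ S n * qpoch q q n))
    by (rewrite qpoch_S, (Cpow_S q (S n)); ring).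
  rewrite Cmod_mult.
  apply Rmult_le_compat_r; [apply Cmod_ge_0|].
  rewrite Cmod_mult.
  pose proof (Cmod_one_minus_le (q ^ S n)) as h1.
  rewrite Cmod_pow in h1. specialize (HN (S n) ltac:(lia)). nra.
Qed.

Lemma ex_qpoch_inf (q : C) : (Cmod q < 1)%R -> exists P, is_qpoch_inf q q P.
Proof.
  intros hq.
  (* The partial sums of [a] telescope to the partial products [qpoch q q n]. *)
  pose (a := fun n => match n with O => 1 | S m => - (q ^ S m * qpoch q q m) end : C).
  assert (Ha : ex_series a).
  { apply ex_series_incr_1.
    apply (ex_series_C_le _ _ (fun n => Req_le _ _ (Cmod_opp _)) (ex_series_Cmod_qpoch_diff q hq)). }
  destruct Ha as [P HP]. exists P.
  apply (filterlim_ext (sum_n a)); [|exact HP].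
  induction x as [|n IH]; [exact (sum_O a)|].
  rewrite sum_Sn, IH. unfold a, plus; simpl. ring.
Qed.

(** The partial sums telescope to 1 / (q;q)_n. The form [P * E = 1] also records that the infinite
    product is nonzero. *)
Lemma is_series_euler_1 (q P : C) :
  (Cmod q < 1)%R -> is_qpoch_inf q q P ->
  exists E : C, is_series (fun m => q ^ m / qpoch q q m) E /\ P * E = 1.
Proof.
  intros hq HP.
  destruct (ex_series_C_le _ _ (fun n => Rle_refl _) (ex_series_Cmod_euler q hq)) as [E HE].
  exists E. split; [exact HE|].
  assert (Hsum : forall n, sum_n (fun m => q ^ m / qpoch q q m) n = / qpoch q q n).
  { induction n as [|n IH].
    - rewrite sum_O. simpl. field.
    - rewrite sum_Sn, IH, qpoch_S. unfold plus; simpl.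
      field. split; [apply (one_minus_pow_neq_0 q (S n) hq); lia|apply qpoch_neq_0, hq]. }
  assert (HE' : filterlim (fun n => / qpoch q q n) eventually (locally E))
    by exact (filterlim_ext _ _ Hsum HE).
  assert (Hone : filterlim (fun n => qpoch q q n * / qpoch q q n) eventually (locally (P * E))).
  (* [filterlim_mult] uses the balls of [Cmod], [locally] on [C] those of the product. *)
  { intros S HS. apply locally_C in HS.
    refine (filterlim_comp_2 (qpoch q q) (fun n => / qpoch q q n) (@mult C_AbsRing) _ _
              (filterlim_mult (K := C_AbsRing) P E) S HS);
      intros U HU; [apply HP|apply HE']; apply locally_C; exact HU. }
  apply (filterlim_locally_unique (fun n => qpoch q q n * / qpoch q q n) _ _ Hone).
  apply (filterlim_ext (fun _ => RtoC 1)).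
  - intros n. symmetry. apply Cinv_r, qpoch_neq_0, hq.
  - apply filterlim_const.
Qed.

(** * The series E(k) and F(k,j) and their linear relations *)

Definition euler_term (q : C) (k m : nat) : C := q ^ (k * m) / qpoch q q m.

Definition lambert_term (q : C) (k j m : nat) : C :=
  q ^ (k * m) / (qpoch q q m * (1 - q ^ (m + j))).

Lemma Cmod_pow_mul_le (q : C) (k m : nat) :
  (Cmod q < 1)%R -> (0 < k)%nat -> (Cmod (q ^ (k * m)) <= Cmod (q ^ m))%R.
Proof.
  intros hq hk. destruct k as [|k]; [lia|].
  simpl. rewrite Cpow_add_r, Cmod_mult, (Cmod_pow _ (k * m)).
  pose proof (Cmod_ge_0 q). pose proof (Cmod_ge_0 (q ^ m)).
  assert (Cmod q ^ (k * m) <= 1)%R by (rewrite <- (pow1 (k * m)); apply pow_incr; lra).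
  nra.
Qed.

(** Since m + j > 0, each |1 - q^(m+j)| is at least 1 - |q|, so a multiple of the series E(1), taken
    in absolute values, dominates. *)
Lemma ex_series_lambert (q : C) (k j : nat) :
  (Cmod q < 1)%R -> (0 < k)%nat -> (0 < j)%nat -> exists F : C, is_series (lambert_term q k j) F.
Proof.
  intros hq hk hj.
  apply (ex_series_C_le _ (fun m => / (1 - Cmod q) * Cmod (q ^ m / qpoch q q m))%R).
  2: { exact (ex_series_scal_l (K := R_AbsRing) (/ (1 - Cmod q))%R _ (ex_series_Cmod_euler q hq)). }
  intros m. unfold lambert_term.
  pose proof (qpoch_neq_0 q m hq) as hp.
  assert (hm : 1 - q ^ (m + j) <> 0) by (apply one_minus_pow_neq_0; [exact hq|lia]).
  replace (q ^ (k * m) / (qpoch q q m * (1 - q ^ (m + j))))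
    with (/ (1 - q ^ (m + j)) * (q ^ (k * m) / qpoch q q m)) by (field; split; assumption).
  rewrite Cmod_mult, Cmod_inv by exact hm.
  apply Rmult_le_compat; [|apply Cmod_ge_0| |].
  - apply Rlt_le, Rinv_0_lt_compat, Cmod_gt_0, hm.
  - apply Rinv_le_contravar; [lra|].
    pose proof (Cmod_one_minus_ge (q ^ (m + j))).
    pose proof (Cmod_pow_le q (m + j) hq ltac:(lia)). lra.
  - rewrite !Cmod_div by exact hp.
    apply Rmult_le_compat_r; [|apply Cmod_pow_mul_le; assumption].
    apply Rlt_le, Rinv_0_lt_compat, Cmod_gt_0, hp.
Qed.


(** Serves differences whose terms carry a factor 1 - q^m: it kills the term m = 0 and cancels the
    last factor of (q;q)_m, which shifts the index by one. *)
Lemma is_series_sub_shift (a b d : nat -> C) (A B c D : C) :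
  a O = b O -> (forall m, a (S m) - b (S m) = c * d m) ->
  is_series a A -> is_series b B -> is_series d D -> A - B = c * D.
Proof.
  intros h0 hS HA HB HD.
  apply (is_series_C_unique (fun m => a m + (-1) * b m)).
  - replace (A - B) with (A + (-1) * B) by ring.
    apply is_series_C_plus; [|apply is_series_C_scal]; assumption.
  - apply is_series_C_decr_1.
    replace (c * D - (a O + (-1) * b O)) with (c * D)
      by (rewrite h0; ring).
    apply (is_series_C_ext (fun m => c * d m)); [|apply is_series_C_scal, HD].
    intros m. rewrite <- hS. ring.
Qed.

(** Induction through E(k) - E(k+1) = q^k E(k), that is, E(k+1) = (1 - q^k) E(k). *)
Lemma is_series_euler (q P : C) (k : nat) :
  (Cmod q < 1)%R -> is_qpoch_inf q q P ->
  exists E : C, is_series (euler_term q (S k)) E /\ P * E = qpoch q q k.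
Proof.
  intros hq HP. induction k as [|k [E [HE HPE]]].
  - destruct (is_series_euler_1 q P hq HP) as [E [HE HPE]].
    exists E. split; [|exact HPE].
    apply (is_series_C_ext (fun m => q ^ m / qpoch q q m)); [|exact HE].
    intros m. unfold euler_term. now rewrite Nat.mul_1_l.
  - exists ((1 - q ^ S k) * E). split.
    2: { rewrite qpoch_S, <- HPE. ring. }
    destruct (ex_series_C_le (euler_term q (S (S k)))
                (fun m => Cmod (q ^ m / qpoch q q m))) as [E' HE'].
    { intros m. unfold euler_term. pose proof (qpoch_neq_0 q m hq) as hp.
      rewrite !Cmod_div by exact hp.
      apply Rmult_le_compat_r; [|apply Cmod_pow_mul_le; [exact hq|lia]].
      apply Rlt_le, Rinv_0_lt_compat, Cmod_gt_0, hp. }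
    { apply ex_series_Cmod_euler, hq. }
    assert (H : E - E' = q ^ S k * E).
    { apply (is_series_sub_shift (euler_term q (S k)) (euler_term q (S (S k))) (euler_term q (S k)));
        try assumption; unfold euler_term.
      - now rewrite !Nat.mul_0_r.
      - intros m. rewrite qpoch_S.
        pose proof (one_minus_pow_neq_0 q (S m) hq ltac:(lia)).
        pose proof (qpoch_neq_0 q m hq).
        replace (S (S k) * S m)%nat with (S k + S k * m + S m)%nat by lia.
        replace (S k * S m)%nat with (S k + S k * m)%nat by lia.
        rewrite !(Cpow_add_r q (S k + S k * m)), !(Cpow_add_r q (S k)).
        set (x := q ^ (S k * m)) in *. set (y := q ^ S k) in *. set (z := q ^ S m) in *.
        field. split; assumption. }
    replace ((1 - q ^ S k) * E) with E'; [exact HE'|].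
    replace E' with (E - (E - E')) by ring. rewrite H. ring.
Qed.

(** The numerator acquires the factor 1 - q^(m+j), which cancels the denominator. *)
Lemma lambert_sub_pow_mul (q : C) (k j : nat) (E F F' : C) :
  (Cmod q < 1)%R -> (0 < j)%nat ->
  is_series (euler_term q k) E -> is_series (lambert_term q k j) F ->
  is_series (lambert_term q (S k) j) F' -> F - q ^ j * F' = E.
Proof.
  intros hq hj HE HF HF'.
  refine (is_series_C_unique _ _ _ _ HE).
  replace (F - q ^ j * F') with (F + (- q ^ j) * F') by ring.
  refine (is_series_C_ext _ _ _ _ (is_series_C_plus _ _ _ _ HF (is_series_C_scal (- q ^ j) _ _ HF'))).
  intros m. unfold lambert_term, euler_term. simpl Nat.mul.
  pose proof (one_minus_pow_neq_0 q (m + j) hq ltac:(lia)) as h1.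
  pose proof (qpoch_neq_0 q m hq).
  rewrite !Cpow_add_r in *. field. split; assumption.
Qed.

(** The factor 1 - q^m shifts m by one, and m + 1 + j is then read as m + (j + 1). *)
Lemma lambert_sub_shift (q : C) (k j : nat) (F F' F'' : C) :
  (Cmod q < 1)%R ->
  is_series (lambert_term q k j) F -> is_series (lambert_term q (S k) j) F' ->
  is_series (lambert_term q k (S j)) F'' -> F - F' = q ^ k * F''.
Proof.
  intros hq HF HF' HF''.
  refine (is_series_sub_shift _ _ _ _ _ _ _ _ _ HF HF' HF''); unfold lambert_term.
  - now rewrite !Nat.mul_0_r.
  - intros m. rewrite qpoch_S.
    pose proof (one_minus_pow_neq_0 q (S m) hq ltac:(lia)).
    pose proof (one_minus_pow_neq_0 q (m + S j) hq ltac:(lia)).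
    pose proof (qpoch_neq_0 q m hq).
    replace (S m + j)%nat with (m + S j)%nat by lia.
    replace (S k * S m)%nat with (k + k * m + S m)%nat by lia.
    replace (k * S m)%nat with (k + k * m)%nat by lia.
    rewrite !(Cpow_add_r q (k + k * m)), !(Cpow_add_r q k).
    set (x := q ^ (k * m)) in *. set (y := q ^ k) in *. set (z := q ^ S m) in *.
    set (w := q ^ (m + S j)) in *.
    field. repeat split; assumption.
Qed.

(** * The truncated pentagonal sum in terms of G(k) *)

Lemma pentagonal_S (k : nat) :
  (S k * (3 * S k - 1) / 2 = k * (3 * k - 1) / 2 + (3 * k + 1))%nat.
Proof.
  (* The increment enters the numerator as an even number, so no parity argument arises. At [k = 0]
     the truncated [3 * k - 1] is harmless, being multiplied by 0. *)
  rewrite <- Nat.div_add by lia. f_equal. destruct k; lia.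
Qed.

(* [F / E] is G(k + 1), the index being shifted to avoid [k = 0]. *)
Lemma truncated_pentagonal (q P : C) (k : nat) :
  (Cmod q < 1)%R -> is_qpoch_inf q q P ->
  forall E F : C, is_series (euler_term q (S k)) E -> is_series (lambert_term q (S k) (S k)) F ->
  E <> 0 ->
  sum_n (fun j : nat => (-1) ^ j * q ^ (j * (3 * j - 1) / 2) * (1 + q ^ j)) k =
    1 + P - (-1) ^ S k * q ^ (S k * (3 * S k - 1) / 2) * (F / E).
Proof.
  intros hq HP. induction k as [|k IH]; intros E F HE HF hE.
  - destruct (is_series_euler_1 q P hq HP) as [E1 [HE1 HPE]].
    assert (E1 = E) as <-.
    { refine (is_series_C_unique _ _ _ HE1 _). refine (is_series_C_ext _ _ _ _ HE).
      intros m. unfold euler_term. now rewrite Nat.mul_1_l. }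
    (* Splitting off the term m = 0 gives E(1) = 1 + q F(1,1); with P = 1 / E(1) the base case
       becomes 2 = 1 + (1 + q F(1,1)) / E(1). *)
    assert (HqF : is_series (fun m => q ^ m / qpoch q q m) (q * F + 1)).
    { apply is_series_C_decr_1.
      replace (q * F + 1 - q ^ 0 / qpoch q q 0) with (q * F) by (simpl; field).
      refine (is_series_C_ext _ _ _ _ (is_series_C_scal q _ _ HF)).
      intros m. unfold lambert_term. rewrite Nat.mul_1_l, qpoch_S.
      pose proof (one_minus_pow_neq_0 q (S m) hq ltac:(lia)) as h1.
      pose proof (qpoch_neq_0 q m hq).
      replace (m + 1)%nat with (S m) by lia. rewrite Cpow_S in *.
      field. split; assumption. }
    pose proof (is_series_C_unique _ _ _ HE1 HqF) as Hrel.
    rewrite sum_O. simpl.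
    replace P with (/ E1) by (rewrite <- (Cmult_1_l (/ E1)), <- HPE; field; exact hE).
    rewrite Hrel in hE |- *. field. exact hE.
  - destruct (is_series_euler q P k hq HP) as [E0 [HE0 HPE0]].
    destruct (is_series_euler q P (S k) hq HP) as [E1 [HE1 HPE1]].
    assert (E1 = E) as -> by exact (is_series_C_unique _ _ _ HE1 HE).
    pose proof (qpoch_neq_0 q k hq) as hpk.
    assert (hP : P <> 0) by (intros ->; apply hpk; rewrite <- HPE0; ring).
    assert (hE0 : E0 <> 0) by (intros ->; apply hpk; rewrite <- HPE0; ring).
    assert (HEE : E = (1 - q ^ S k) * E0).
    { rewrite qpoch_S, <- HPE0 in HPE1.
      replace E with (/ P * (P * E)) by (field; exact hP). rewrite HPE1. field. exact hP. }
    destruct (ex_series_lambert q (S k) (S k) hq ltac:(lia) ltac:(lia)) as [F0 HF0].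
    destruct (ex_series_lambert q (S (S k)) (S k) hq ltac:(lia) ltac:(lia)) as [X HX].
    destruct (ex_series_lambert q (S (S (S k))) (S k) hq ltac:(lia) ltac:(lia)) as [Y HY].
    (* With K = [S k], [X] is F(K+1,K) and [Y] is F(K+2,K). Eliminating both from the three
       relations leaves the recurrence between G(K) and G(K+1). *)
    pose proof (lambert_sub_pow_mul q _ (S k) _ _ _ hq ltac:(lia) HE0 HF0 HX) as R1.
    pose proof (lambert_sub_pow_mul q _ (S k) _ _ _ hq ltac:(lia) HE HX HY) as R2.
    pose proof (lambert_sub_shift q _ _ _ _ _ hq HX HY HF) as R3.
    rewrite sum_Sn, (IH E0 F0 HE0 HF0 hE0), (pentagonal_S (S k)).
    pose proof (one_minus_pow_neq_0 q (S k) hq ltac:(lia)) as hx.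
    (* The coefficient q^(3K+1) of the recurrence is written as [x * x * y]. *)
    replace (3 * S k + 1)%nat with (S k + (S k + S (S k)))%nat by lia.
    rewrite !Cpow_add_r, (Cpow_S (-1) (S k)).
    set (x := q ^ S k) in *. set (y := q ^ S (S k)) in *.
    set (s := (-1) ^ S k). set (Q := q ^ (S k * (3 * S k - 1) / 2)).
    assert (HF0E : F0 = E0 + x * X) by (rewrite <- R1; ring).
    assert (HX1 : X = (E - x * y * F) / (1 - x)).
    { rewrite <- R2. replace (x * y * F) with (x * (y * F)) by ring. rewrite <- R3. field. exact hx. }
    rewrite HF0E, HX1, HEE. unfold plus; simpl.
    field. split; assumption.
Qed.

(** * The q-binomial series as a combination of Lambert-type series *)

Lemma is_series_zero_prefix (a : nat -> C) (n : nat) (A : C) :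
  (forall m, (m < n)%nat -> a m = 0) -> is_series (fun m => a (m + n)%nat) A -> is_series a A.
Proof.
  revert a. induction n as [|n IH]; intros a h0 HA.
  - refine (is_series_C_ext _ _ _ _ HA). intros m. now rewrite Nat.add_0_r.
  - apply is_series_C_decr_1.
    replace (A - a O) with A by (rewrite h0 by lia; ring).
    apply IH.
    + intros m hm. apply h0. lia.
    + refine (is_series_C_ext _ _ _ _ HA). intros m. f_equal. lia.
Qed.

(** Put w = q^(n-1). The quotient (q;q)_(n-2) / (q;q)_n is 1 / ((1-w)(1-qw)), which splits as
    (1/(1-w) - q/(1-qw)) / (1-q). The first [k] terms vanish with the q-binomial. *)
Lemma is_series_qbinom_lambert (q X X' : C) (k : nat) :
  (Cmod q < 1)%R ->
  is_series (lambert_term q (S (S k)) (S k)) X ->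
  is_series (lambert_term q (S (S k)) (S (S k))) X' ->
  is_series
    (fun m : nat =>
       q ^ (S k * (S k - 1) / 2 + (S k + 1) * (m + 2)) / qpoch q q (m + 2)
       * qbinom q (m + 2 - 2) (S k - 1))
    (q ^ (S k * (S k - 1) / 2 + S (S k) * S (S k)) / (qpoch q q k * (1 - q)) * (X - q * X')).
Proof.
  intros hq HX HX'.
  apply (is_series_zero_prefix _ k).
  - intros m hm. unfold qbinom.
    replace (Nat.leb (S k - 1) (m + 2 - 2)) with false
      by (symmetry; apply Nat.leb_gt; lia). ring.
  - replace (X - q * X') with (X + (- q) * X') by ring.
    refine (is_series_C_ext _ _ _ _ (is_series_C_scal _ _ _
             (is_series_C_plus _ _ _ _ HX (is_series_C_scal (- q) _ _ HX')))).
    intros m. unfold qbinom, lambert_term.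
    replace (m + k + 2 - 2)%nat with (m + k)%nat by lia.
    replace (S k - 1)%nat with k by lia.
    replace (Nat.leb k (m + k)) with true by (symmetry; apply Nat.leb_le; lia).
    replace (m + k - k)%nat with m by lia.
    replace (m + k + 2)%nat with (S (S (m + k))) by lia.
    replace ((S k + 1) * S (S (m + k)))%nat with (S (S k) * S (S k) + S (S k) * m)%nat by lia.
    rewrite Nat.add_assoc, (Cpow_add_r q (S k * k / 2 + _)), !qpoch_S.
    replace (m + S k)%nat with (S (m + k)) by lia.
    replace (m + S (S k))%nat with (S (S (m + k))) by lia.
    pose proof (one_minus_pow_neq_0 q (S (m + k)) hq ltac:(lia)) as h1.
    pose proof (one_minus_pow_neq_0 q (S (S (m + k))) hq ltac:(lia)) as h2.
    pose proof (qpoch_neq_0 q m hq) as h3.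
    pose proof (qpoch_neq_0 q k hq) as h4.
    pose proof (qpoch_neq_0 q (m + k) hq) as h5.
    pose proof (one_minus_neq_0 q hq) as h6.
    rewrite (Cpow_S q (S (m + k))) in *.
    set (c := q ^ (S k * k / 2 + S (S k) * S (S k))).
    set (d := q ^ (S (S k) * m)).
    set (w := q ^ S (m + k)) in *.
    field. repeat split; assumption.
Qed.

Theorem theorem1 (k : nat) (q : C) (hk : (0 < k)%nat) (hq : (Cmod q < 1)%R) :
  exists P S : C,
    is_qpoch_inf q q P /\
    is_series
      (fun m : nat =>
         let n := (m + 2)%nat in
         q ^ (k * (k - 1) / 2 + (k + 1) * n) / qpoch q q n * qbinom q (n - 2) (k - 1)) S /\
    sum_n (fun j : nat => (-1) ^ j * q ^ (j * (3 * j - 1) / 2) * (1 + q ^ j)) (k - 1) =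
      1 - (-1) ^ k * q ^ (k * (3 * k - 1) / 2) / (1 - q ^ k + q ^ (2 * k))
      + P * (1 - (1 - q) * (- q) ^ k / (q * (1 - q ^ k + q ^ (2 * k))) * S).
Proof.
  destruct k as [|k]; [lia|]. clear hk.
  destruct (ex_qpoch_inf q hq) as [P HP].
  destruct (is_series_euler q P k hq HP) as [E [HE HPE]].
  destruct (ex_series_lambert q (S k) (S k) hq ltac:(lia) ltac:(lia)) as [F HF].
  destruct (ex_series_lambert q (S k) (S (S k)) hq ltac:(lia) ltac:(lia)) as [F' HF'].
  destruct (ex_series_lambert q (S (S k)) (S k) hq ltac:(lia) ltac:(lia)) as [X HX].
  destruct (ex_series_lambert q (S (S k)) (S (S k)) hq ltac:(lia) ltac:(lia)) as [X' HX'].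
  exists P, (q ^ (S k * (S k - 1) / 2 + S (S k) * S (S k)) / (qpoch q q k * (1 - q)) * (X - q * X')).
  split; [exact HP|]. split; [exact (is_series_qbinom_lambert q X X' k hq HX HX')|].
  pose proof (qpoch_neq_0 q k hq) as hp.
  assert (hE : E <> 0) by (intros ->; apply hp; rewrite <- HPE; ring).
  pose proof (lambert_sub_pow_mul q _ (S k) _ _ _ hq ltac:(lia) HE HF HX) as R1.
  pose proof (lambert_sub_pow_mul q _ (S (S k)) _ _ _ hq ltac:(lia) HE HF' HX') as R2.
  pose proof (lambert_sub_shift q _ _ _ _ _ hq HF HX HF') as R3.
  replace (S k - 1)%nat with k by lia.
  rewrite (truncated_pentagonal q P k hq HP E F HE HF hE).
  match goal with |- @eq _ ?a ?b => change (@eq C a b) end.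
  assert (hD : 1 - q ^ S k + q ^ (2 * S k) <> 0).
  { rewrite Nat.mul_comm, Cpow_mult_r. apply cyclotomic6_neq_0.
    pose proof (Cmod_pow_le q (S k) hq ltac:(lia)). lra. }
  replace (- q) with ((-1) * q) by ring. rewrite Cpow_mult_l.
  (* With K = [S k], both K(3K-1)/2 and the exponent in the series value are written as K(K-1)/2 +
     K^2 plus a remainder, so that both sides share the power [Q]. *)
  replace (S k * (3 * S k - 1) / 2)%nat with (S k * k / 2 + S k * S k)%nat.
  2: { rewrite <- Nat.div_add by lia. f_equal. lia. }
  replace (S k * k / 2 + S (S k) * S (S k))%nat
    with (S k * k / 2 + S k * S k + (S k + (S k + 1)))%nat by lia.
  replace (2 * S k)%nat with (S k + S k)%nat in * by lia.
  rewrite (Cpow_add_r q (S k * k / 2 + S k * S k)).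
  rewrite !(Cpow_add_r q (S k)) in *. rewrite Cpow_1_r.
  (* The right-hand side divides by q, so q = 0 is treated apart; both exponents are positive, hence
     these powers vanish there. *)
  assert (HQ : q = 0 -> q ^ (S k * k / 2 + S k * S k) = 0).
  { intros ->. replace (S k * k / 2 + S k * S k)%nat
      with (S (S k * k / 2 + (S k * S k - 1)))%nat by lia. simpl. ring. }
  assert (Hx : q = 0 -> q ^ S k = 0) by (intros ->; simpl; ring).
  rewrite Cpow_S in R2.
  set (Q := q ^ (S k * k / 2 + S k * S k)) in *.
  set (x := q ^ S k) in *. set (s := (-1) ^ S k).
  destruct (Ceq_dec q 0) as [hq0|hq0].
  - (* Here [/ q] is the junk value [0], but [(- q) ^ k = 0] anyway. *)
    rewrite HQ, Hx by exact hq0. unfold Cdiv. ring.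
  (* [R1] and [R2] turn the left-hand side into x^2 (F - F'); then [R3] replaces x F' by F - X, and
     [R1] replaces x X by F - E. *)
  - assert (key : x * x * x * (X - q * X') = (1 - x + x * x) * F - E).
    { replace (x * x * x * (X - q * X'))
        with (x * x * (F + (F' - q * x * X') - (F - x * X)) - x * (x * F')) by ring.
      rewrite R1, R2, <- R3. replace E with (F - x * X) by exact R1. ring. }
    (* The product P times the series value contains P / (q;q)_k, which becomes 1 / E and matches
       the denominator of G. *)
    rewrite <- HPE in hp |- *.
    assert (hP : P <> 0) by (intros ->; apply hp; ring).
    pose proof (one_minus_neq_0 q hq) as h1q.
    replace F with ((x * x * x * (X - q * X') + E) / (1 - x + x * x)).
    2: { rewrite key. field. exact hD. }
    field. repeat split; assumption.
Qed.
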